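(* Let $\{S_i\}_{i=1}^m$ be a self-similar iterated function system in $\mathbb{R}^2$ with attractor $K$ such that all $S_i$ are homotheties and $K$ is a $1$-set that is not contained in any line. Then there are at most finitely many lines $M$ through the origin such that the orthogonal projection $\Pi_M$ onto $M$ is an interval projection of $K$.
   Context: A self-similar iterated function system (SS-IFS) in $\mathbb{R}^2$ is a finite collection $\{S_i\}_{i=1}^m$ of contracting similarities $S_i:\mathbb{R}^2\to\mathbb{R}^2$. Its attractor is the unique nonempty compact set $K$ with $K=\bigcup_{i=1}^m S_i(K)$. A similarity $S:\mathbb{R}^2\to\mathbb{R}^2$ is a homothety if there are $r\in\mathbb{R}\setminus\{0\}$ (possibly negative) and $v\in\mathbb{R}^2$ with $S(x)=rx+v$ for all $x$. $K$ is a $1$-set if $0<\mathcal{H}^1(K)<\infty$, where $\mathcal{H}^1$ is $1$-dimensional Hausdorff measure. For a line $M\subseteq\mathbb{R}^2$ through the origin, $\Pi_M:\mathbb{R}^2\to M$ is the orthogonal projection onto $M$; it is called an interval projection of $K$ if $\Pi_M(K)$ is an interval under the identification $M=\mathbb{R}$ (a single point counts as a closed interval of length $0$). *)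

(* Defs.v *)
From HB Require Import structures.
From mathcomp Require Import all_boot all_order all_algebra.
From mathcomp Require Import all_classical all_reals all_analysis.
From mathcomp Require Import ring.
Set Implicit Arguments.
Unset Strict Implicit.
Unset Printing Implicit Defensive.
Import Order.TTheory GRing.Theory Num.Theory.
Import numFieldNormedType.Exports.
Local Open Scope classical_set_scope.
Local Open Scope ring_scope.

(* The library norm `|x| on row vectors is the sup norm, hence a separate
   Euclidean norm here; the topology on 'rV[R]_2 (used by [compact]) is the
   same for both. *)
Definition dot (R : realType) (x y : 'rV[R]_2) : R := \sum_i x 0 i * y 0 i.

Definition enorm (R : realType) (x : 'rV[R]_2) : R := Num.sqrt (dot x x).

Definition contracting_similarity (R : realType)
    (f : 'rV[R]_2 -> 'rV[R]_2) : Prop :=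
  exists r : R, 0 < r < 1 /\ forall x y, enorm (f x - f y) = r * enorm (x - y).

Definition homothety (R : realType) (f : 'rV[R]_2 -> 'rV[R]_2) : Prop :=
  exists r : R, exists v : 'rV[R]_2, r != 0 /\ forall x, f x = r *: x + v.

(* For contracting similarities S i there is exactly one such K (Hutchinson). *)
Definition is_attractor (R : realType) (m : nat)
    (S : 'I_m -> 'rV[R]_2 -> 'rV[R]_2) (K : set 'rV[R]_2) : Prop :=
  [/\ K !=set0, compact K & K = \bigcup_(i in [set: 'I_m]) (S i @` K)].

(* The element 0 only matters for the empty set, whose diameter is thus 0
   and not -oo. *)
Definition ediam (R : realType) (A : set 'rV[R]_2) : \bar R :=
  ereal_sup (0%E |` [set (enorm (x - y))%:E | x in A & y in A]).

Definition hausdorff1_pre (R : realType) (delta : R) (A : set 'rV[R]_2) :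
    \bar R :=
  ereal_inf [set (\sum_(0 <= k <oo) ediam (U k))%E |
    U in [set U : nat -> set 'rV[R]_2 |
            A `<=` \bigcup_k U k /\ forall k, (ediam (U k) <= delta%:E)%E]].

(* Increasing as delta decreases, so the limit as delta -> 0+ is a supremum. *)
Definition hausdorff1 (R : realType) (A : set 'rV[R]_2) : \bar R :=
  ereal_sup [set hausdorff1_pre delta A | delta in [set delta : R | 0 < delta]].

Definition one_set (R : realType) (A : set 'rV[R]_2) : Prop :=
  (0 < hausdorff1 A < +oo)%E.

Definition is_line (R : realType) (L : set 'rV[R]_2) : Prop :=
  exists p : 'rV[R]_2, exists M : {vspace 'rV[R]_2},
    \dim M = 1%N /\ L = [set x | x - p \in M].

Definition orth_proj (R : realType) (M : {vspace 'rV[R]_2})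
    (x : 'rV[R]_2) : 'rV[R]_2 :=
  xget 0 [set y | y \in M /\ forall z, z \in M -> dot (x - y) z = 0].

(* The line M is identified with R by t |-> t *: e for a unit vector e of M. *)
Definition interval_projection (R : realType) (K : set 'rV[R]_2)
    (M : {vspace 'rV[R]_2}) : Prop :=
  exists e : 'rV[R]_2, [/\ e \in M, enorm e = 1 &
    is_interval [set t : R | (orth_proj M @` K) (t *: e)]].

Lemma dotE (R : realType) (x y : 'rV[R]_2) :
  dot x y = x 0 ord0 * y 0 ord0 + x 0 ord_max * y 0 ord_max.
Proof.
rewrite /dot big_ord_recl big_ord1; congr (_ + _ * _); congr (fun_of_matrix _ _ _);
  exact/val_inj.
Qed.

(* The default value 0 in orth_proj is never used. *)
Lemma orth_projP (R : realType) (M : {vspace 'rV[R]_2}) (x : 'rV[R]_2) :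
  \dim M = 1%N ->
  orth_proj M x \in M /\ forall z, z \in M -> dot (x - orth_proj M x) z = 0.
Proof.
move=> dM; have M0 : vpick M != 0 by rewrite vpick0 -dimv_eq0 dM.
have eM : (<[vpick M]> = M)%VS.
  by apply/eqP; rewrite eqEdim -memvE memv_pick dim_vline M0 dM.
set u := vpick M in M0 eM.
have uu : dot u u != 0.
  apply: contra_neq M0; rewrite dotE -!expr2 => /eqP.
  rewrite paddr_eq0 ?sqr_ge0// !sqrf_eq0 => /andP[/eqP a /eqP b].
  apply/rowP => i; rewrite mxE; case: i => [[|[|//]] hi].
  - by rewrite -[RHS]a; congr (u 0 _); apply/val_inj.
  - by rewrite -[RHS]b; congr (u 0 _); apply/val_inj.
rewrite /orth_proj; case: xgetP => [y _ //|/(_ ((dot x u / dot u u) *: u))] [].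
split; first by rewrite memvZ// /u memv_pick.
move=> z; rewrite -eM => /vlineP[k ->].
have : dot (x - (dot x u / dot u u) *: u) u = 0.
  transitivity (dot x u - (dot x u / dot u u) * dot u u).
    by rewrite !dotE !mxE; ring.
  by rewrite divfK// subrr.
by rewrite !dotE !mxE => h; rewrite !(mulrCA _ k) -mulrDr h mulr0.
Qed.

(* Main.v *)
(* The extreme values of [x |-> dot x u] on [K] are attained in pieces [S i],
   [S j], and for a fixed pair [(i, j)] they are [dot p u] and [dot q u] with
   [p], [q] independent of [u].  So it suffices to exclude three interval
   projections, in directions [u1], [u2], [u3], with the same [p] and [q].

   As [0 < H^1(K) < oo], disjoint cylinders of [K] have total ratio at most 1.
   A maximality argument with a Vitali covering produces, for every word [w0],
   finite families [W] of disjoint cylinders containing that of [w0] whose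
   projections cover every interval projection of [K] up to small length.  They
   thus nearly tile it, and comparing second moments about the midpoint, with
   [c = (p + q) / 2] and [d = p - q], the quadratic form
     [\sum_(w in W) |r_w| (dot (S_w c - c) u)^2
        + (\sum_(w in W) |r_w|^3 - 1) (dot d u)^2 / 12]
   nearly vanishes at [u1], [u2], [u3], hence at all [u].  At [u] orthogonal to
   [d] it is at least [|r_w0| (dot (S_w0 c - c) u)^2].  So every [S_w0 c] lies
   on the line [c + R d], and as these points accumulate at all of [K], so does
   [K]. *)
Require Import Defs.
From HB Require Import structures.
From mathcomp Require Import all_boot all_order all_algebra.
From mathcomp Require Import all_classical all_reals all_analysis.
From mathcomp Require Import ring lra.
Set Implicit Arguments.
Unset Strict Implicit.
Unset Printing Implicit Defensive.
Import Order.TTheory GRing.Theory Num.Theory.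
Import numFieldNormedType.Exports.
Local Open Scope classical_set_scope.
Local Open Scope ring_scope.

(** * Covers of an interval and monotone functions *)

Definition clamp (R : realType) (a b x : R) : R := Num.max a (Num.min b x).

Lemma clamp_id (R : realType) (a b x : R) : a <= x <= b -> clamp a b x = x.
Proof. by case/andP=> ax xb; rewrite /clamp min_r// max_r. Qed.

Lemma clamp_ge (R : realType) (a b x : R) : a <= clamp a b x.
Proof. by rewrite /clamp le_max lexx. Qed.

Lemma clamp_le (R : realType) (a b x : R) : a <= b -> clamp a b x <= b.
Proof. by move=> ab; rewrite /clamp ge_max ab ge_min lexx. Qed.

Lemma clamp_homo (R : realType) (a b : R) : {homo clamp a b : x y / x <= y}.
Proof.
by move=> x y xy; rewrite /clamp le_max2// le_min2.
Qed.

(** At least one of the two clamped points on the right is [c], which cancels [- G c]; the other is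
    then [clamp a b x]. *)
Lemma clamp_split (R : realType) (G : R -> R) (a c b x : R) : a <= c <= b ->
  G (clamp a b x) = G (clamp a c x) + G (clamp c b x) - G c.
Proof.
case/andP=> ac cb; have ab := le_trans ac cb.
case: (leP x c) => xc.
  have -> : clamp c b x = c by rewrite /clamp; apply: max_l; rewrite ge_min xc orbT.
  have -> : clamp a b x = clamp a c x.
    by rewrite /clamp !min_r// (le_trans xc).
  by rewrite addrK.
have -> : clamp a c x = c by rewrite /clamp min_l ?max_r// ltW.
have -> : clamp a b x = clamp c b x.
  rewrite /clamp; have h : c <= Num.min b x by rewrite le_min cb ltW.
  by rewrite !max_r// (le_trans ac).
by rewrite addrC addKr.
Qed.

(** Subadditivity of the measure [dG], by induction on the cover: the first interval, clamped to
    [[a, b]], leaves a gap on either side, and the remaining intervals cover both gaps. *)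
Lemma increment_le_cover (R : realType) (G : R -> R) (s : seq (R * R)) (a b : R) :
    a <= b -> {in `[a, b] &, {homo G : x y / x <= y}} ->
    (forall j, j \in s -> j.1 <= j.2) ->
    (forall x, a < x < b -> exists2 j, j \in s & j.1 <= x <= j.2) ->
  G b - G a <= \sum_(j <- s) (G (clamp a b j.2) - G (clamp a b j.1)).
Proof.
elim: s a b => [|[c d] s IH] a b ab Gm sle cov.
  rewrite big_nil; move: ab; rewrite le_eqVlt => /predU1P[->|ab].
    by rewrite subrr.
  (* An empty cover would miss the midpoint. *)
  by have [|j] := cov ((a + b) / 2); rewrite ?in_nil// ; lra.
have cd : c <= d by apply: (sle (c, d)); rewrite mem_head.
rewrite big_cons/=; set c' := clamp a b c; set d' := clamp a b d.
have ac' : a <= c' by exact: clamp_ge.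
have c'd' : c' <= d' by exact: clamp_homo.
have d'b : d' <= b by exact: clamp_le.
have sle' j : j \in s -> j.1 <= j.2.
  by move=> js; apply: sle; rewrite in_cons js orbT.
have sub (x y : R) : a <= x -> y <= b -> {in `[x, y] &, {homo G : x y / x <= y}}.
  move=> ax yb t1 t2; rewrite !in_itv/= => /andP[h1 h2] /andP[h3 h4].
  by apply: Gm; rewrite in_itv/=; lra.
have I1 : G c' - G a <= \sum_(j <- s) (G (clamp a c' j.2) - G (clamp a c' j.1)).
  apply: IH => //; first by apply: sub => //; lra.
  move=> x /andP[ax xc'].
  have [|j] := cov x; first lra.
  rewrite in_cons => /predU1P[->/= /andP[cx _]|js jx]; last by exists j.
  move: xc'; rewrite /c' /clamp lt_max lt_min (ltNge x c) cx andbF orbF.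
  by rewrite ltNge ltW.
have I2 : G b - G d' <= \sum_(j <- s) (G (clamp d' b j.2) - G (clamp d' b j.1)).
  apply: IH => //; first by apply: sub => //; lra.
  move=> x /andP[d'x xb].
  have [|j] := cov x; first lra.
  rewrite in_cons => /predU1P[->/= /andP[_ xd]|js jx]; last by exists j.
  move: d'x; rewrite /d' /clamp gt_max gt_min (ltNge d x) xd orbF => /andP[_ bx].
  by lra.
apply: (@le_trans _ _ (G d' - G c' + \sum_(j <- s)
    ((G (clamp a c' j.2) - G (clamp a c' j.1)) +
     (G (clamp d' b j.2) - G (clamp d' b j.1))))).
  by rewrite big_split/=; lra.
rewrite lerD2l big_seq [leRHS]big_seq; apply: ler_sum => j js.
rewrite (@clamp_split _ G a c' b j.2) ?(@clamp_split _ G a c' b j.1); last 2 first.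
- by rewrite ac' (le_trans c'd').
- by rewrite ac' (le_trans c'd').
rewrite (@clamp_split _ G c' d' b j.2) ?(@clamp_split _ G c' d' b j.1); last 2 first.
- by rewrite c'd'.
- by rewrite c'd'.
(* After splitting at [c'] and [d'], the outer parts agree with the two induction bounds; the middle
   part only has to be nonnegative. *)
suff : G (clamp c' d' j.1) <= G (clamp c' d' j.2) by lra.
apply: (sub c' d') => //.
- by rewrite in_itv/= clamp_ge clamp_le.
- by rewrite in_itv/= clamp_ge clamp_le.
- exact/clamp_homo/sle'.
Qed.

(** * The Euclidean plane *)

Section Planar.
Variable R : realType.
Implicit Types (x y z u : 'rV[R]_2) (a b : R).

Lemma dotC x y : dot x y = dot y x.
Proof. by rewrite !dotE; ring. Qed.

Lemma dotDl x y z : dot (x + y) z = dot x z + dot y z.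
Proof. by rewrite !dotE !mxE; ring. Qed.

Lemma dotBl x y z : dot (x - y) z = dot x z - dot y z.
Proof. by rewrite !dotE !mxE; ring. Qed.

Lemma dotZl a x z : dot (a *: x) z = a * dot x z.
Proof. by rewrite !dotE !mxE; ring. Qed.

Lemma dot_ge0 x : 0 <= dot x x.
Proof. by rewrite dotE addr_ge0// -expr2 sqr_ge0. Qed.

Lemma enorm_ge0 x : 0 <= enorm x.
Proof. exact: sqrtr_ge0. Qed.

Lemma enormZ a x : enorm (a *: x) = `|a| * enorm x.
Proof.
by rewrite /enorm dotZl dotC dotZl mulrA -expr2 sqrtrM ?sqr_ge0// sqrtr_sqr.
Qed.

Lemma rV2P x y : x 0 ord0 = y 0 ord0 -> x 0 ord_max = y 0 ord_max -> x = y.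
Proof.
move=> h0 h1; apply/rowP => -[[|[|//]] hi].
- by rewrite (_ : Ordinal hi = ord0)//; exact/val_inj.
- by rewrite (_ : Ordinal hi = ord_max)//; exact/val_inj.
Qed.

Lemma dot_eq0 x : dot x x = 0 -> x = 0.
Proof.
rewrite dotE -!expr2 => /eqP; rewrite paddr_eq0 ?sqr_ge0// !sqrf_eq0.
by case/andP=> /eqP a /eqP b; apply: rV2P; rewrite mxE.
Qed.

Lemma enorm_gt0 x : x != 0 -> 0 < enorm x.
Proof.
by move=> x0; rewrite sqrtr_gt0 lt0r dot_ge0 andbT; apply: contra_neq x0 => /dot_eq0.
Qed.

Lemma enorm1_neq0 x : enorm x = 1 -> x != 0.
Proof.
by apply: contra_eq_neq => ->; rewrite -(scale0r 0) enormZ normr0 mul0r eq_sym oner_eq0.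
Qed.

Lemma dot_enorm x y : `|dot x y| <= enorm x * enorm y.
Proof.
rewrite /enorm -sqrtrM ?dot_ge0// -sqrtr_sqr ler_wsqrtr//.
rewrite -subr_ge0 !dotE.
set a := x 0 ord0; set b := x 0 ord_max; set c := y 0 ord0; set d := y 0 ord_max.
(* Lagrange's identity: the defect in the Cauchy-Schwarz inequality is a squared determinant. *)
by rewrite (_ : _ - _ = (a * d - b * c) ^+ 2) ?sqr_ge0//; ring.
Qed.

Lemma dot_continuous u : continuous (fun x => dot x u).
Proof.
move=> x; rewrite (_ : (fun x => dot x u) =
    fun x => x 0 ord0 * u 0 ord0 + x 0 ord_max * u 0 ord_max); last first.
  by apply/funext => y; rewrite dotE.
apply: (@continuousD R _ _ (fun x => x 0 ord0 * u 0 ord0)); apply: continuousM;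
  solve [exact: coord_continuous | exact: cst_continuous].
Qed.

Lemma enorm_continuous : continuous (@enorm R).
Proof.
move=> x; apply: (@continuous_comp _ _ _ (fun x => dot x x)); last exact: sqrt_continuous.
rewrite (_ : (fun x => dot x x) =
    fun x => x 0 ord0 * x 0 ord0 + x 0 ord_max * x 0 ord_max); last first.
  by apply/funext => y; rewrite dotE.
by apply: (@continuousD R _ _ (fun x => x 0 ord0 * x 0 ord0));
  apply: continuousM; exact: coord_continuous.
Qed.

Lemma enormB_continuous : continuous (fun z : 'rV[R]_2 * 'rV[R]_2 => enorm (z.1 - z.2)).
Proof.
move=> z; apply: (@continuous_comp _ _ _
  (fun z : 'rV[R]_2 * 'rV[R]_2 => z.1 - z.2) (@enorm R)); last exact: enorm_continuous.
by apply: (@continuousB R _ _ fst snd); [exact: cvg_fst|exact: cvg_snd].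
Qed.

Lemma compact_enorm_bounded (K : set 'rV[R]_2) : K !=set0 -> compact K ->
  exists2 D, 0 <= D & forall x y, K x -> K y -> enorm (x - y) <= D.
Proof.
move=> [x0 Kx0] cK.
have [|z _ zmax] := compact_EVT_max _ (compact_setX cK cK)
    (continuous_subspaceT enormB_continuous).
  by exists (x0, x0).
exists (enorm (z.1 - z.2)); first exact: enorm_ge0.
by move=> x y Kx Ky; apply: (zmax (x, y)); rewrite inE.
Qed.

Lemma compact_disjoint_gap (A B : set 'rV[R]_2) : compact A -> compact B ->
  A `&` B = set0 ->
  exists2 e, 0 < e & forall x y, A x -> B y -> e <= enorm (x - y).
Proof.
move=> cA cB AB0.
have [[x0 Ax0]|/nonemptyPn A0] := pselect (A !=set0); last first.
  by exists 1 => // x y; rewrite A0.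
have [[y0 By0]|/nonemptyPn B0] := pselect (B !=set0); last first.
  by exists 1 => // x y; rewrite B0.
have [|[x y] xyAB xymin] := compact_EVT_min _ (compact_setX cA cB)
    (continuous_subspaceT enormB_continuous).
  by exists (x0, y0).
rewrite inE in xyAB; case: xyAB => /= Ax By.
exists (enorm (x - y)); last by move=> x' y' *; apply: (xymin (x', y')); rewrite inE.
apply: enorm_gt0; rewrite subr_eq0; apply/eqP => xy.
by have : (A `&` B) x by [split=> //; rewrite xy]; rewrite AB0.
Qed.

End Planar.

(** * Disjoint similar copies in a 1-set *)

Section Hausdorff.
Variable R : realType.
Implicit Types (A B K : set 'rV[R]_2) (U : nat -> set 'rV[R]_2).

Lemma ediam_ge0 A : (0 <= ediam A)%E.
Proof. by apply: ereal_sup_ubound; left. Qed.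

Lemma enorm_le_ediam A x y : A x -> A y -> ((enorm (x - y))%:E <= ediam A)%E.
Proof. by move=> Ax Ay; apply: ereal_sup_ubound; right; exists x => //; exists y. Qed.

Lemma ediam_le A (M : \bar R) : (0 <= M)%E ->
  (forall x y, A x -> A y -> ((enorm (x - y))%:E <= M)%E) -> (ediam A <= M)%E.
Proof. by move=> M0 AM; apply: ge_ereal_sup => _ [->//|[x Ax [y Ay <-]]]; exact: AM. Qed.

Lemma ediam_set0 : ediam (set0 : set 'rV[R]_2) = 0%E.
Proof. by apply/eqP; rewrite eq_le ediam_ge0 andbT; apply: ediam_le. Qed.

Lemma hausdorff1_pre_le A U (e : R) : A `<=` \bigcup_k U k ->
  (forall k, (ediam (U k) <= e%:E)%E) ->
  (hausdorff1_pre e A <= \sum_(0 <= k <oo) ediam (U k))%E.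
Proof. by move=> AU Ue; apply: ereal_inf_lbound; exists U. Qed.

Lemma ediam_preimage K B (f : 'rV[R]_2 -> 'rV[R]_2) (rho : R) : 0 < rho ->
    (forall x y, enorm (f x - f y) = rho * enorm (x - y)) ->
  (rho%:E * ediam (K `&` f @^-1` B) <= ediam B)%E.
Proof.
move=> rho0 fE; rewrite muleC -lee_pdivlMr//; apply: ediam_le.
  by rewrite mule_ge0 ?ediam_ge0// lee_fin invr_ge0 ltW.
move=> x y [_ Bx] [_ By]; rewrite lee_pdivlMr// -EFinM mulrC -fE.
exact: enorm_le_ediam.
Qed.

(* A cover of [K] by sets too small to meet two of the disjoint images
   [f i @` K] restricts to covers of each image, and these pull back to [K]. *)
Lemma hausdorff1_pre_disjoint K n (f : 'I_n -> 'rV[R]_2 -> 'rV[R]_2)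
    (rho : 'I_n -> R) (gap e e' : R) :
    (forall i, 0 < rho i) ->
    (forall i x y, enorm (f i x - f i y) = rho i * enorm (x - y)) ->
    (forall i, f i @` K `<=` K) ->
    (forall i j x y, i != j -> K x -> K y -> gap <= enorm (f i x - f j y)) ->
    e < gap -> (forall i, e <= e' * rho i) ->
  (\sum_i (rho i)%:E * hausdorff1_pre e' K <= hausdorff1_pre e K)%E.
Proof.
move=> rho0 fE fK fgap egap ee'; apply: le_ereal_inf_tmp => _ [U [KU Ue] <-].
pose V i k := K `&` f i @^-1` U k.
apply: (@le_trans _ _ (\sum_(0 <= k <oo) \sum_i (rho i)%:E * ediam (V i k))%E).
  rewrite nneseries_sum; last first.
    by move=> i k _; rewrite mule_ge0 ?ediam_ge0// lee_fin ltW.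
  apply: lee_sum => i _; rewrite nneseriesZl; last by move=> k _; exact: ediam_ge0.
  rewrite lee_pmul2l// ?lte_fin//; apply: hausdorff1_pre_le.
    move=> x Kx; have [k _ Uk] := KU _ (fK i _ (imageP _ Kx)).
    by exists k.
  move=> k; rewrite -(@lee_pmul2l _ (rho i)%:E) ?lte_fin//.
  rewrite (le_trans (ediam_preimage _ _ (rho0 i) (fE i)))//.
  by rewrite (le_trans (Ue k))// -EFinM lee_fin mulrC.
apply: lee_nneseries => [k _ _|k _].
  by apply: sume_ge0 => i _; rewrite mule_ge0 ?ediam_ge0// lee_fin ltW.
have [[i [x Vx]]|V0] := pselect (exists i, V i k !=set0); last first.
  rewrite big1 ?ediam_ge0// => i _.
  have -> : V i k = set0.
    by apply/eqP/negPn/negP => /set0P Vi; apply: V0; exists i.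
  by rewrite ediam_set0 mule0.
rewrite (bigD1 i)//= big1 ?adde0; first exact: ediam_preimage.
move=> j ji; suff -> : V j k = set0 by rewrite ediam_set0 mule0.
rewrite -subset0 => y [Ky Uy]; case: Vx => Kx Ux.
have := @enorm_le_ediam (U k) _ _ Uy Ux; move=> /le_trans/(_ (Ue k)); rewrite lee_fin.
by move=> /(le_trans (fgap _ _ _ _ ji Ky Kx)); rewrite leNgt egap.
Qed.

(** Disjoint compact copies lie at positive distance, so fine covers split among them and each copy
    uses up [rho i] times the measure of [K]. This measure is positive and finite and can be divided
    out. *)
Lemma sum_ratio_le1 K n (f : 'I_n -> 'rV[R]_2 -> 'rV[R]_2) (rho : 'I_n -> R) :
    compact K -> one_set K ->
    (forall i, 0 < rho i) ->
    (forall i x y, enorm (f i x - f i y) = rho i * enorm (x - y)) ->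
    (forall i, continuous (f i)) ->
    (forall i, f i @` K `<=` K) ->
    (forall i j, i != j -> f i @` K `&` f j @` K = set0) ->
  \sum_i rho i <= 1.
Proof.
move=> cK /andP[H0 Hoo] rho0 fE fc fK fdisj.
have [gap gap0 fgap] : exists2 gap, 0 < gap &
    forall i j x y, i != j -> K x -> K y -> gap <= enorm (f i x - f j y).
  have : \forall gap \near 0^'+, forall ij : 'I_n * 'I_n, ij.1 != ij.2 ->
      forall x y, K x -> K y -> gap <= enorm (f ij.1 x - f ij.2 y).
    (* There are finitely many pairs, so a gap close enough to 0 serves all of them. *)
    apply: filter_forall => -[i j]/=.
    have [->|ij] := eqVneq i j; first by near=> g.
    have [||e e0 He] := @compact_disjoint_gap R (f i @` K) (f j @` K) _ _ (fdisj _ _ ij).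
    - exact/continuous_compact/cK/continuous_subspaceT/fc.
    - exact/continuous_compact/cK/continuous_subspaceT/fc.
    near=> g => _ x y Kx Ky; apply: (@le_trans _ _ e); last by apply: He; exact: imageP.
    by near: g; exact: nbhs_right_le.
  move=> near_gap.
  have [g [g0 Hg]] : exists g : R, 0 < g /\ forall ij : 'I_n * 'I_n, ij.1 != ij.2 ->
      forall x y, K x -> K y -> g <= enorm (f ij.1 x - f ij.2 y).
    near (0 : R)^'+ => g; exists g; split; last exact: (near near_gap g).
    by near: g; exact: nbhs_right_gt.
  by exists g => // i j x y ij; exact: (Hg (i, j)).
have Hfin : hausdorff1 K \is a fin_num by rewrite ge0_fin_numE// ltW.
set h := fine (hausdorff1 K).
have h0 : 0 < h by rewrite fine_gt0// H0 Hoo.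
have hE : hausdorff1 K = h%:E by rewrite fineK.
suff : (\sum_i rho i) * h <= h by rewrite -[leRHS]mul1r ler_pM2r.
apply/ler_addgt0Pr => eps eps0.
have s0 : 0 <= \sum_i rho i by apply: sumr_ge0 => i _; exact: ltW.
set s := \sum_i rho i in s0 *.
(* This error gets multiplied by [s] below and must stay under [eps]; the added 1 allows for
   [s = 0]. *)
have t0 : 0 < eps / (s + 1) by rewrite divr_gt0// ltr_wpDl.
have [_ [e' /= e'0 <-] He'] := ub_ereal_sup_adherent t0 Hfin.
rewrite -/(hausdorff1 K) hE in He'.
have [e [e0 egap ee']] : exists e : R, [/\ 0 < e, e < gap & forall i, e <= e' * rho i].
  near (0 : R)^'+ => e; exists e; split.
  - by near: e; exact: nbhs_right_gt.
  - by near: e; exact: nbhs_right_lt.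
  - near: e; apply: filter_forall => i; apply: nbhs_right_le.
    by rewrite mulr_gt0.
have H1 := hausdorff1_pre_disjoint rho0 fE fK fgap egap ee'.
have H2 : (hausdorff1_pre e K <= h%:E)%E by rewrite -hE; apply: ereal_sup_ubound; exists e.
have : (\sum_i (rho i)%:E * (h - eps / (s + 1))%:E <= h%:E)%E.
  apply: le_trans H2; apply: le_trans H1; apply: lee_sum => i _.
  by rewrite lee_pmul2l// ?lte_fin// ltW.
under eq_bigr do rewrite -EFinM.
rewrite sumEFin lee_fin -mulr_suml -/s => H3.
have : s * (eps / (s + 1)) <= eps.
  by rewrite mulrCA ger_pMr// ler_pdivrMr; lra.
by lra.
Unshelve. all: by end_near. Qed.

End Hausdorff.

(** * Second moments of a near tiling *)

Lemma clamp_sub_le (R : realType) (a b x y : R) : x <= y ->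
  clamp a b y - clamp a b x <= y - x.
Proof. by move=> xy; rewrite /clamp /Num.max /Num.min; do 6?case: ifPn; lra. Qed.

(** The pieces lie in [[a, b]] and contribute their full increments. The exceptional intervals may
    stick out; they are clamped and estimated by the Lipschitz constant [M]. *)
Lemma increment_le_pieces (R : realType) (T : eqType) (G : R -> R) (M : R)
    (W : seq T) (lo hi : T -> R) (E : seq (R * R)) (a b : R) :
    a <= b -> 0 <= M ->
    (forall x y, a <= x -> x <= y -> y <= b -> 0 <= G y - G x <= M * (y - x)) ->
    (forall w, w \in W -> [/\ a <= lo w, lo w <= hi w & hi w <= b]) ->
    (forall j, j \in E -> j.1 <= j.2) ->
    (forall x, a < x < b -> (exists2 w, w \in W & lo w <= x <= hi w) \/
                            (exists2 j, j \in E & j.1 <= x <= j.2)) ->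
  G b - G a <= \sum_(w <- W) (G (hi w) - G (lo w)) + M * \sum_(j <- E) (j.2 - j.1).
Proof.
move=> ab M0 GM Wab Ele cov.
have := @increment_le_cover R G ([seq (lo w, hi w) | w <- W] ++ E) a b ab.
rewrite big_cat big_map/= => /(_ _ _ _)/le_trans; apply.
- move=> x y; rewrite !in_itv/= => /andP[ax _] /andP[_ yb] xy.
  by have /andP[+ _] := GM x y ax xy yb; rewrite subr_ge0.
- move=> j; rewrite mem_cat => /orP[/mapP[w Ww ->]|]; last exact: Ele.
  by have [] := Wab w Ww.
- move=> x /cov[[w Ww wx]|[j Ej jx]].
    by exists (lo w, hi w) => //; rewrite mem_cat map_f.
  by exists j; rewrite // mem_cat Ej orbT.
apply: lerD.
  rewrite big_seq [leRHS]big_seq; apply: ler_sum => w Ww.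
  have [h1 h2 h3] := Wab w Ww.
  by rewrite !clamp_id//; lra.
rewrite mulr_sumr big_seq [leRHS]big_seq; apply: ler_sum => j Ej.
have cj : clamp a b j.1 <= clamp a b j.2 by exact/clamp_homo/Ele.
have /andP[_ /le_trans] := GM _ _ (clamp_ge a b j.1) cj (clamp_le _ ab); apply.
by rewrite ler_wpM2l// clamp_sub_le// Ele.
Qed.

(* The two bounds come from covering with respect to the densities
   [(x - c)^2] and [(l/2)^2 - (x - c)^2], both nonnegative on [[a, b]]; the
   second one needs that the pieces have total length at most [l]. *)
Lemma second_moment_pieces (R : realType) (T : eqType) (W : seq T)
    (t m : T -> R) (E : seq (R * R)) (a b eta : R) :
    let l := b - a in let c := (a + b) / 2 in
    0 < l -> (forall w, w \in W -> 0 <= t w) -> \sum_(w <- W) t w <= 1 ->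
    (forall w, w \in W -> a <= m w - t w * l / 2 /\ m w + t w * l / 2 <= b) ->
    (forall j, j \in E -> j.1 <= j.2) -> \sum_(j <- E) (j.2 - j.1) <= eta ->
    (forall x, a < x < b ->
      (exists2 w, w \in W & m w - t w * l / 2 <= x <= m w + t w * l / 2) \/
      (exists2 j, j \in E & j.1 <= x <= j.2)) ->
  `|\sum_(w <- W) (t w * (m w - c) ^+ 2 + t w ^+ 3 * l ^+ 2 / 12) - l ^+ 2 / 12|
    <= eta * l / 4.
Proof.
move=> l c l0 t0 t1 Wab Ele Eeta cov.
pose M := (l / 2) ^+ 2; have M0 : 0 <= M by exact: sqr_ge0.
pose G x := (x - c) ^+ 3 / 3.
(* Parallel axis theorem for the interval with centre [m w] and length [t w * l], as [G] is a
   primitive of [(x - c)^2]. *)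
have GE w : G (m w + t w * l / 2) - G (m w - t w * l / 2) =
    l * (t w * (m w - c) ^+ 2 + t w ^+ 3 * l ^+ 2 / 12).
  by rewrite /G; field.
have GM x y : a <= x -> x <= y -> y <= b -> 0 <= G y - G x <= M * (y - x).
  move=> ax xy yb.
  have -> : G y - G x =
      (y - x) * (((y - c) ^+ 2 + (x - c) * (y - c) + (x - c) ^+ 2) / 3).
    by rewrite /G; field.
  set X := x - c; set Y := y - c.
  have hX : - (l / 2) <= X <= l / 2 by rewrite /X /c /l; lra.
  have hY : - (l / 2) <= Y <= l / 2 by rewrite /Y /c /l; lra.
  have X2 : X ^+ 2 <= M by rewrite /M; nra.
  have Y2 : Y ^+ 2 <= M by rewrite /M; nra.
  have S0 : 0 <= Y ^+ 2 + X * Y + X ^+ 2 by nra.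
  have SM : Y ^+ 2 + X * Y + X ^+ 2 <= 3 * M by nra.
  have yx : 0 <= y - x by lra.
  rewrite mulr_ge0 ?divr_ge0//= mulrC ler_wpM2r//; lra.
have Wab' w : w \in W -> [/\ a <= m w - t w * l / 2,
    m w - t w * l / 2 <= m w + t w * l / 2 & m w + t w * l / 2 <= b].
  move=> Ww; have [h1 h2] := Wab w Ww; split => //.
  have : 0 <= t w * l by rewrite mulr_ge0 ?t0// ltW.
  by lra.
have ab : a <= b by rewrite -subr_ge0 ltW.
have Gba : G b - G a = l * (l ^+ 2 / 12) by rewrite /G /c /l; field.
have ME : M * \sum_(j <- E) (j.2 - j.1) <= l * (eta * l / 4).
  by rewrite (_ : l * (eta * l / 4) = M * eta) ?ler_wpM2l// /M; field.
have H1 := increment_le_pieces ab M0 GM Wab' Ele cov.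
(* A primitive of the complementary density: covering with respect to it bounds the second moment
   from above. *)
pose G' x := M * x - G x.
have GM' x y : a <= x -> x <= y -> y <= b -> 0 <= G' y - G' x <= M * (y - x).
  by move=> ax xy yb; have := GM x y ax xy yb; rewrite /G'; lra.
have H2 := increment_le_pieces ab M0 GM' Wab' Ele cov.
have E1 : \sum_(w <- W) (G (m w + t w * l / 2) - G (m w - t w * l / 2)) =
    l * \sum_(w <- W) (t w * (m w - c) ^+ 2 + t w ^+ 3 * l ^+ 2 / 12).
  by rewrite mulr_sumr; apply: eq_bigr => w _; exact: GE.
have E2 : \sum_(w <- W) (G' (m w + t w * l / 2) - G' (m w - t w * l / 2)) =
    M * l * \sum_(w <- W) t w -
    l * \sum_(w <- W) (t w * (m w - c) ^+ 2 + t w ^+ 3 * l ^+ 2 / 12).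
  rewrite -E1 mulr_sumr -sumrB; apply: eq_bigr => w _.
  by rewrite /G'; field.
have Gba' : G' b - G' a = M * l - l * (l ^+ 2 / 12).
  by rewrite -Gba /G' /l; ring.
rewrite {}E1 Gba in H1; rewrite {}E2 Gba' in H2.
have Ml : M * l * \sum_(w <- W) t w <= M * l.
  by rewrite ger_pMr// mulr_gt0// exprn_gt0// divr_gt0.
by rewrite ler_norml; apply/andP; split; rewrite -(ler_pM2l l0); lra.
Qed.

(** * Cylinders and near tilings *)

(** Vitali selection, with [d] as disjointness and [f] as size: elements are tested from large to
    small, so a rejected one meets a selected one at least as large. *)
Lemma greedy_disjoint_subseq (R : realType) (T : eqType) (f : T -> R) (d : rel T)
    (A : seq T) : (forall x, ~~ d x x) -> symmetric d ->
  exists W, [/\ {subset W <= A}, pairwise d W &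
    forall x, x \in A -> exists2 y, y \in W & ~~ d x y && (f x <= f y)].
Proof.
move=> dxx dC.
pose le_f := [rel x y | f x <= f y].
have le_trf : transitive le_f by move=> y x z; exact: le_trans.
have : sorted le_f (sort le_f A) by apply: sort_sorted => x y; exact: le_total.
suff sortedW s : sorted le_f s -> exists W, [/\ {subset W <= s}, pairwise d W &
    forall x, x \in s -> exists2 y, y \in W & ~~ d x y && (f x <= f y)].
  move=> /sortedW[W [Ws Wd Wf]]; exists W; split=> // x.
    by move/Ws; rewrite mem_sort.
  by rewrite -(mem_sort le_f) => /Wf.
elim: s => [_|x s IH /= xs]; first by exists [::].
have [W [Ws Wd Wf]] := IH (path_sorted xs).
have sx : {in s, forall y, f x <= f y} by move=> y ys; have /allP/(_ y ys) := order_path_min le_trf xs.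
have [dW|/allPn[y Wy dxy]] := boolP (all (d x) W).
  exists (x :: W); split=> [y||y].
  - by rewrite !inE => /predU1P[->|/Ws ->]; rewrite ?eqxx ?orbT.
  - by rewrite /= dW Wd.
  - rewrite inE => /predU1P[->|/Wf[z Wz hz]]; first by exists x; rewrite ?inE ?eqxx ?dxx /=.
    by exists z => //; rewrite inE Wz orbT.
exists W; split=> // [y'|y'].
- by move/Ws; rewrite inE orbC => ->.
- rewrite inE => /predU1P[->|/Wf//]; exists y => //.
  by rewrite dxy sx// Ws.
Qed.

Section Words.
Variables (R : realType) (m : nat) (r : 'I_m -> R) (v : 'I_m -> 'rV[R]_2).
Variable K : set 'rV[R]_2.
Implicit Types (w : seq 'I_m) (W : seq (seq 'I_m)) (x y : 'rV[R]_2).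

(** The first letter is applied last, so extending a word on the right shrinks its cylinder. *)
Definition word_map w x : 'rV[R]_2 := foldr (fun i y => r i *: y + v i) x w.

(** Signed: a negative value means that the word reverses the order of projected points. Lengths
    scale by its absolute value. *)
Definition word_ratio w : R := \prod_(i <- w) r i.

Definition cylinder w : set 'rV[R]_2 := word_map w @` K.

Lemma word_mapB w x y : word_map w x - word_map w y = word_ratio w *: (x - y).
Proof.
elim: w => [|i w IH]; first by rewrite /word_ratio big_nil scale1r.
by rewrite /word_ratio big_cons -scalerA -/(word_ratio w) -IH /= scalerBr opprD addrACA subrr addr0.
Qed.

Lemma dot_word_map w x y u :
  dot (word_map w x) u = dot (word_map w y) u + word_ratio w * (dot x u - dot y u).
Proof. by rewrite -dotBl -dotZl -word_mapB dotBl addrC subrK. Qed.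

Lemma enorm_word_map w x y :
  enorm (word_map w x - word_map w y) = `|word_ratio w| * enorm (x - y).
Proof. by rewrite word_mapB enormZ. Qed.

Lemma word_map_continuous w : continuous (word_map w).
Proof.
elim: w => [|i w IH] x; first exact: cvg_id.
apply: (@continuousD R _ _ (fun x => r i *: word_map w x)); last exact: cst_continuous.
by apply: continuousZr; exact: IH.
Qed.

Hypothesis r_neq0 : forall i, r i != 0.
Hypothesis r_lt1 : forall i, `|r i| < 1.
Hypothesis K0 : K !=set0.
Hypothesis cK : compact K.
Hypothesis KE : K = \bigcup_(i in [set: 'I_m]) ((fun x => r i *: x + v i) @` K).

Lemma word_ratio_neq0 w : word_ratio w != 0.
Proof. by rewrite /word_ratio prodf_seq_neq0; apply/allP => i _ /=; exact: r_neq0. Qed.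

Lemma word_map_stable w x : K x -> K (word_map w x).
Proof. by move=> Kx; elim: w => [|i w IH]//=; rewrite KE; exists i => //; exists (word_map w x). Qed.

Lemma cylinder_cover N x : K x -> exists2 w, size w = N & cylinder w x.
Proof.
elim: N x => [|N IH] x Kx; first by exists [::] => //; exists x.
move: Kx; rewrite KE => -[i _ [y Ky <-]].
have [w wN [z Kz zy]] := IH y Ky.
by exists (i :: w); [rewrite /= wN|exists z => //=; rewrite zy].
Qed.

Lemma word_ratio_small e : 0 < e ->
  exists N, forall w, size w = N -> `|word_ratio w| <= e.
Proof.
move=> e0.
(* The alphabet is finite, so one bound below 1 works for all letters. *)
have [rho [rho0 rho1 rrho]] : exists rho : R, [/\ 0 < rho, rho < 1 & forall i, `|r i| <= rho].
  near (1 : R)^'- => rho; exists rho; split.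
  - by near: rho; exact: nbhs_left_gt.
  - by near: rho; exact: nbhs_left_lt.
  - near: rho; apply: filter_forall => i; exact: nbhs_left_ge.
have rhoN : rho ^+ n @[n --> \oo] --> 0 by apply: cvg_expr; rewrite ger0_norm// ltW.
have /cvgr0Pnorm_le/(_ _ e0)[N _ HN] := rhoN.
exists N => w wN; apply: le_trans (HN N (leqnn N)) => /=.
rewrite (ger0_norm (exprn_ge0 N (ltW rho0))) -wN normr_prod.
elim: w {wN} => [|i w IH]; first by rewrite big_nil expr0.
by rewrite big_cons exprS ler_pM// prodr_ge0.
Unshelve. all: by end_near. Qed.

(** Boolean by classical reflection, so that it can serve as a relation for [pairwise] and for the
    Vitali selection. *)
Definition disjoint_cylinders w w' : bool := `[< cylinder w `&` cylinder w' = set0 >].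

Lemma disjoint_cylindersP w w' :
  ~~ disjoint_cylinders w w' -> exists2 z, cylinder w z & cylinder w' z.
Proof. by move=> /asboolPn/eqP/set0P[z []]; exists z. Qed.

Lemma sum_word_ratio_le1 W : one_set K -> pairwise disjoint_cylinders W ->
  \sum_(w <- W) `|word_ratio w| <= 1.
Proof.
move=> K1 Wd; rewrite (big_nth [::]) big_mkord.
apply: (@sum_ratio_le1 R K _ (fun i : 'I_(size W) => word_map (nth [::] W i))) => //.
- by move=> i; rewrite normr_gt0 word_ratio_neq0.
- by move=> i x y; rewrite enorm_word_map.
- by move=> i; exact: word_map_continuous.
- by move=> i _ [x Kx <-]; exact: word_map_stable.
have /(pairwiseP [::]) {}Wd := Wd.
move=> i j ij; case: (ltngtP i j) => [lij|lji|/val_inj eij]; last by rewrite eij eqxx in ij.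
  by apply/asboolP/(Wd i j) => //; rewrite inE.
by rewrite setIC; apply/asboolP/(Wd j i) => //; rewrite inE.
Qed.

(* [W] nearly maximizes the total ratio, so that a disjoint family of pieces
   away from [W] has small total ratio; by the Vitali covering argument such a
   family, enlarged, covers what [W] misses. *)
Lemma near_tiling (v0 : seq 'I_m) (eta : R) : one_set K -> 0 < eta ->
  exists W, [/\ v0 \in W, \sum_(w <- W) `|word_ratio w| <= 1 &
    forall (u c : 'rV[R]_2) (h : R), enorm u = 1 -> (forall x, K x -> `|dot x u - dot c u| <= h) ->
    exists E : seq (R * R), [/\ forall j, j \in E -> j.1 <= j.2,
      \sum_(j <- E) (j.2 - j.1) <= eta &
      forall x, K x ->
        (exists2 w, w \in W &
           `|dot x u - dot (word_map w c) u| <= `|word_ratio w| * h) \/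
        (exists2 j, j \in E & j.1 <= dot x u <= j.2)]].
Proof.
move=> K1 eta0; have [D D0 KD] := compact_enorm_bounded K0 cK.
have [x0 Kx0] := K0.
(* Only families containing [v0] compete, so that a near maximizer contains it too. *)
pose total := [set \sum_(w <- W) `|word_ratio w| |
  W in [set W : seq (seq 'I_m) | v0 \in W /\ pairwise disjoint_cylinders W]].
have total_sup : has_sup total.
  split; first by exists (\sum_(w <- [:: v0]) `|word_ratio w|), [:: v0] => //=; rewrite inE.
  by exists 1 => _ [W [_ Wd] <-]; exact: sum_word_ratio_le1.
(* Each interval of [E1] below has length [4 * D] times a ratio; with this bound on the ratios they
   use at most [eta / 2]. *)
have e1 : 0 < eta / (8 * (D + 1)) by rewrite divr_gt0// mulr_gt0//; lra.
have [_ [W [v0W Wd] <-] Wsup] := sup_adherent e1 total_sup.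
have [n n0 Wn] : exists2 n : R, 0 < n & (size W)%:R <= n.
  by exists (size W).+1%:R; rewrite ?ltr0n ?ler_nat.
(* The strips of width [s * D] on both sides of every piece of [W] use at most the other
   [eta / 2]. *)
have s0 : 0 < eta / (4 * (D + 1) * n).
  by rewrite divr_gt0// !mulr_gt0//; lra.
set s := eta / _ in s0; have [N HN] := word_ratio_small s0.
pose A := [seq w <- [seq val t | t <- enum {: N.-tuple 'I_m}] |
           all (disjoint_cylinders ^~ w) W].
have dC : symmetric disjoint_cylinders by move=> w w'; rewrite /disjoint_cylinders setIC.
have dI w : ~~ disjoint_cylinders w w.
  apply/asboolPn => w0; suff : (cylinder w `&` cylinder w) (word_map w x0) by rewrite w0.
  by split; exists x0.
have [W' [W'A W'd W'f]] := greedy_disjoint_subseq (fun w => `|word_ratio w|) A dI dC.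
(* [W ++ W'] is again an admissible family, and [W] nearly attains the supremum. *)
have W'sum : \sum_(w <- W') `|word_ratio w| <= eta / (8 * (D + 1)).
  have : \sum_(w <- W ++ W') `|word_ratio w| <= sup total.
    apply: sup_upper_bound => //; exists (W ++ W') => //; split.
      by rewrite mem_cat v0W.
    rewrite pairwise_cat Wd W'd !andbT; apply/allrelP => w w' Ww /W'A.
    by rewrite mem_filter => /andP[/allP/(_ w Ww)].
  by rewrite big_cat/=; lra.
exists W; split=> //; first exact: sum_word_ratio_le1.
(* [W] is fixed before the direction [u], so the same family serves several directions. *)
move=> u c h u1 Kh.
have dot_le x y : `|dot x u - dot y u| <= enorm (x - y).
  by rewrite -dotBl (le_trans (dot_enorm _ _))// u1 mulr1.
have cylD w x y : cylinder w x -> cylinder w y -> enorm (x - y) <= `|word_ratio w| * D.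
  by move=> [x' Kx' <-] [y' Ky' <-]; rewrite enorm_word_map ler_wpM2l// KD.
pose M w := dot (word_map w c) u.
(* These intervals contain the projection of every cylinder that meets that of [w] and has no larger
   ratio. *)
pose E1 := [seq (dot (word_map w x0) u - 2 * (`|word_ratio w| * D),
                 dot (word_map w x0) u + 2 * (`|word_ratio w| * D)) | w <- W'].
pose E2 := [seq (M w - `|word_ratio w| * h - s * D, M w - `|word_ratio w| * h) | w <- W].
pose E3 := [seq (M w + `|word_ratio w| * h, M w + `|word_ratio w| * h + s * D) | w <- W].
have sD : 0 <= s * D by rewrite mulr_ge0// ltW.
have rD w : 0 <= `|word_ratio w| * D by rewrite mulr_ge0.
exists (E1 ++ E2 ++ E3); split.
- move=> j; rewrite !mem_cat => /or3P[] /mapP[w _ ->] /=; have := rD w; lra.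
- rewrite !big_cat !big_map/=.
  rewrite (eq_bigr (fun w => 4 * D * `|word_ratio w|)); last by move=> w _; ring.
  rewrite -mulr_sumr.
  rewrite [X in _ + (X + _)](eq_bigr (fun w => s * D)); last by move=> w _; ring.
  rewrite [X in _ + (_ + X)](eq_bigr (fun w => s * D)); last by move=> w _; ring.
  rewrite !big_const_seq !count_predT !iter_addr_0.
  have S1 : 4 * D * \sum_(w <- W') `|word_ratio w| <= eta / 2.
    apply: (@le_trans _ _ (4 * (D + 1) * (eta / (8 * (D + 1))))).
      by apply: ler_pM => //; [rewrite mulr_ge0|exact: sumr_ge0|lra].
    by rewrite le_eqVlt; apply/orP; left; apply/eqP; field; lra.
  have S2 : s * D *+ size W <= eta / 4.
    rewrite -mulr_natr -mulrA mulrC.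
    apply: (@le_trans _ _ ((D + 1) * n * s)).
      apply: ler_wpM2r; first exact: ltW.
      by apply: ler_pM => //; lra.
    rewrite /s le_eqVlt; apply/orP; left; apply/eqP; field.
    by apply/andP; split; lra.
  by lra.
(* Either the small cylinder around [x] avoids all of [W] and meets a selected one of at least its
   ratio, or it meets a piece of [W] and [x] projects to within [s * D] of that piece. *)
move=> x Kx; have [w wN wx] := cylinder_cover N Kx.
have [wA|/allPn[w0 Ww0]] := boolP (all (disjoint_cylinders ^~ w) W).
  have /W'f[w' W'w' /andP[/disjoint_cylindersP[z wz w'z] ww']] : w \in A.
    rewrite mem_filter wA/=; apply/mapP.
    by exists (Tuple (introT eqP wN)) => //; rewrite mem_enum.
  right; eexists; first by rewrite mem_cat; apply/orP; left; apply: map_f; exact: W'w'.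
  have w'x0 : cylinder w' (word_map w' x0) by exists x0.
  have xz := le_trans (dot_le x z) (cylD _ _ _ wx wz).
  have zx0 := le_trans (dot_le z _) (cylD _ _ _ w'z w'x0).
  have := ler_wpM2r D0 ww'; move: xz zx0; rewrite /= !ler_norml; lra.
move=> /disjoint_cylindersP[z w0z wz].
have xz : `|dot x u - dot z u| <= s * D.
  rewrite (le_trans (dot_le x z))// (le_trans (cylD _ _ _ wx wz))//.
  by rewrite ler_wpM2r// HN.
have zM : `|dot z u - M w0| <= `|word_ratio w0| * h.
  case: w0z => y Ky <-; rewrite (dot_word_map w0 y c) addrC addKr normrM.
  by rewrite ler_wpM2l// Kh.
have [xM|xM] := leP `|dot x u - M w0| (`|word_ratio w0| * h); first by left; exists w0.
right; have [xw0|xw0] := leP (dot x u) (M w0).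
  exists (M w0 - `|word_ratio w0| * h - s * D, M w0 - `|word_ratio w0| * h).
    by rewrite !mem_cat (map_f _ Ww0) orbT.
  by move: xM xz zM; rewrite (ler0_norm (_ : dot x u - M w0 <= 0)) ?subr_le0// !ler_norml/=; lra.
exists (M w0 + `|word_ratio w0| * h, M w0 + `|word_ratio w0| * h + s * D).
  by rewrite !mem_cat (map_f _ Ww0) !orbT.
by move: xM xz zM; rewrite (gtr0_norm (_ : 0 < dot x u - M w0)) ?subr_gt0// !ler_norml/=; lra.
Qed.

End Words.

(** * Directions and the main argument *)

Section Perp.
Variable R : realType.
Implicit Types (x y z u n d : 'rV[R]_2).

(** A quarter turn: [dot x (perp d)] is the determinant of [d] and [x], nonzero exactly when they
    are linearly independent. *)
Definition perp d : 'rV[R]_2 := \row_i (if i == ord0 then - d 0 ord_max else d 0 ord0).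

Lemma dot_perp x d : dot x (perp d) = x 0 ord_max * d 0 ord0 - x 0 ord0 * d 0 ord_max.
Proof. by rewrite dotE !mxE/=; ring. Qed.

Lemma perp_eq0 d : perp d = 0 -> d = 0.
Proof.
move=> /rowP d0; apply: rV2P; rewrite !mxE.
  by have := d0 ord_max; rewrite !mxE.
by have := d0 ord0; rewrite !mxE/= => /eqP; rewrite oppr_eq0 => /eqP.
Qed.

Lemma dot_perp_vline x d : d != 0 -> dot x (perp d) = 0 -> x \in <[d]>%VS.
Proof.
move=> d0; rewrite dot_perp => /eqP; rewrite subr_eq0 => /eqP xd.
have dd : dot d d != 0 by apply: contra_neq d0 => /dot_eq0.
apply/vlineP; exists (dot x d / dot d d).
rewrite dotE in dd; apply: rV2P; rewrite !mxE !dotE.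
  by apply: (mulIf dd); rewrite mulrAC divfK//; ring: xd.
by apply: (mulIf dd); rewrite mulrAC divfK//; ring: xd.
Qed.

(* For fixed [x], [n |-> dot x n ^+ 2] is a binary quadratic form, so Lagrange
   interpolation recovers it from three projectively distinct nodes. *)
Lemma dot_sqr_interpolation u1 u2 u3 n :
    dot u1 (perp u2) != 0 -> dot u1 (perp u3) != 0 -> dot u2 (perp u3) != 0 ->
  exists l1 l2 l3, forall x,
    dot x n ^+ 2 = l1 * dot x u1 ^+ 2 + l2 * dot x u2 ^+ 2 + l3 * dot x u3 ^+ 2.
Proof.
move=> h12 h13 h23.
exists (dot n (perp u2) * dot n (perp u3) / (dot u1 (perp u2) * dot u1 (perp u3))),
  (- (dot n (perp u1) * dot n (perp u3)) / (dot u1 (perp u2) * dot u2 (perp u3))),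
  (dot n (perp u1) * dot n (perp u2) / (dot u1 (perp u3) * dot u2 (perp u3))).
move=> x; move: h12 h13 h23; rewrite !dot_perp !dotE => h12 h13 h23; field.
by rewrite h12 h13 h23.
Qed.

(** The equation describes the line through [c] directed by [perp n], since turning twice is
    negation. *)
Lemma not_subset_perp_line (K : set 'rV[R]_2) c n :
    (forall L : set 'rV[R]_2, is_line L -> ~ K `<=` L) -> n != 0 ->
  ~ (forall x, K x -> dot (x - c) n = 0).
Proof.
move=> Kline n0 Kn.
have pn0 : perp n != 0 by apply: contra_neq n0 => /perp_eq0.
apply: (Kline [set x | x - c \in <[perp n]>%VS]).
  by exists c, <[perp n]>%VS; split; rewrite // dim_vline pn0.
move=> x /Kn xn; apply: (dot_perp_vline pn0).
have ppn : perp (perp n) = - n by apply: rV2P; rewrite !mxE.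
by rewrite ppn dotC -scaleN1r dotZl dotC xn mulr0.
Qed.

Lemma orth_proj_unit (M : {vspace 'rV[R]_2}) e x : \dim M = 1%N -> e \in M ->
  enorm e = 1 -> orth_proj M x = dot x e *: e.
Proof.
move=> dM eM e1; have ee : dot e e = 1.
  by rewrite -(sqr_sqrtr (dot_ge0 e)) -/(enorm e) e1 expr1n.
have e0 := enorm1_neq0 e1.
have ME : (<[e]> = M)%VS by apply/eqP; rewrite eqEdim -memvE eM dim_vline e0 dM.
have [pM xp] := orth_projP x dM.
have := xp e eM; rewrite dotBl => /eqP; rewrite subr_eq0 => /eqP ->.
have /vlineP[k ->] : orth_proj M x \in <[e]>%VS by rewrite ME.
by rewrite dotZl ee mulr1.
Qed.

End Perp.

(** * Extreme values of projections, and three directions with common endpoints *)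

Section Homotheties.
Variables (R : realType) (m : nat) (r : 'I_m -> R) (v : 'I_m -> 'rV[R]_2).
Variable K : set 'rV[R]_2.
Hypothesis r_neq0 : forall i, r i != 0.
Hypothesis r_lt1 : forall i, `|r i| < 1.
Hypothesis K0 : K !=set0.
Hypothesis cK : compact K.
Hypothesis KE : K = \bigcup_(i in [set: 'I_m]) ((fun x => r i *: x + v i) @` K).

Local Notation f := (word_map r v).
Local Notation ratio := (word_ratio r).

(** Piece [i] attains the maximum and piece [j] the minimum. The finitely many pairs divide the
    directions into classes in which the endpoints of the projection depend linearly on [u]. *)
Definition extremal_pieces u i j :=
  (exists2 x, K x & forall z, K z -> dot z u <= dot (r i *: x + v i) u) /\
  (exists2 x, K x & forall z, K z -> dot (r j *: x + v j) u <= dot z u).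

Lemma piece_stable i x : K x -> K (r i *: x + v i).
Proof. by move=> Kx; rewrite KE; exists i => //; exists x. Qed.

Lemma ex_extremal_pieces u : exists i j, extremal_pieces u i j.
Proof.
have cu := continuous_subspaceT (@dot_continuous R u) : {within K, continuous (fun x => dot x u)}.
have [x + xmax] := compact_EVT_max K0 cK cu.
have [y + ymin] := compact_EVT_min K0 cK cu.
rewrite !inE {1 2}KE => -[j _ [y' Ky' yE]] [i _ [x' Kx' xE]].
exists i, j; split; [exists x' => //|exists y' => //] => z Kz.
- by rewrite xE; apply: xmax; rewrite inE.
- by rewrite yE; apply: ymin; rewrite inE.
Qed.

(* The two extremal values in direction [u] satisfy the linear system of [p]
   and [q] below, which has a unique solution as all ratios are less than 1. *)
Lemma extremal_endpoints i j : exists p q, forall u, extremal_pieces u i j ->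
  [/\ exists2 x, K x & dot x u = dot p u, exists2 x, K x & dot x u = dot q u &
    forall z, K z -> dot q u <= dot z u <= dot p u].
Proof.
have ri := r_lt1 i; have rj := r_lt1 j.
have ri0 : 0 < 1 - r i by move: ri; rewrite ltr_norml; lra.
have rj0 : 0 < 1 - r j by move: rj; rewrite ltr_norml; lra.
have rij0 : 0 < 1 - r i * r j.
  rewrite subr_gt0 (le_lt_trans (ler_norm _))// normrM.
  by rewrite mulr_ilt1.
have solve1 k x y : 0 < 1 - r k -> x = (1 - r k)^-1 *: y -> x = r k *: x + y :> 'rV[R]_2.
  move=> rk ->; rewrite -{3}(scale1r y) scalerA -scalerDl; congr (_ *: _).
  by field; rewrite gt_eqF.
(* A map of negative ratio exchanges maximum and minimum, hence the four sign cases. When both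
   ratios are negative, [p] and [q] refer to each other and substitution gives the factor
   [1 - r i * r j]. *)
have [p [q [pE qE]]] : exists p q,
    p = r i *: (if 0 < r i then p else q) + v i /\
    q = r j *: (if 0 < r j then q else p) + v j.
  case: (0 < r i); case: (0 < r j).
  - exists ((1 - r i)^-1 *: v i), ((1 - r j)^-1 *: v j); split; exact: solve1.
  - exists ((1 - r i)^-1 *: v i), (r j *: ((1 - r i)^-1 *: v i) + v j).
    by split => //; exact: solve1.
  - exists (r i *: ((1 - r j)^-1 *: v j) + v i), ((1 - r j)^-1 *: v j).
    by split => //; exact: solve1.
  - pose p := (1 - r i * r j)^-1 *: (r i *: v j + v i).
    exists p, (r j *: p + v j); split => //.
    rewrite scalerDr scalerA -addrA /p.
    rewrite -{3}(scale1r (r i *: v j + v i)) scalerA -scalerDl; congr (_ *: _).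
    by field; rewrite gt_eqF.
exists p, q => u [[x Kx xmax] [y Ky ymin]].
have KSx := piece_stable i Kx; have KSy := piece_stable j Ky.
set b := dot (r i *: x + v i) u in xmax; set a := dot (r j *: y + v j) u in ymin.
(* One inequality comes from the point [x] attaining the maximum in piece [i], the other from
   mapping an extremal point of [K] by that piece back into [K]. *)
have bE : b = r i * (if 0 < r i then b else a) + dot (v i) u.
  have bx : b = r i * dot x u + dot (v i) u by rewrite /b dotDl dotZl.
  apply/eqP; rewrite eq_le; case: ifPn => ri_pos; apply/andP; split.
  - by rewrite {1}bx lerD2r ler_pM2l// xmax.
  - by have := xmax _ (piece_stable i KSx); rewrite dotDl dotZl.
  - by rewrite {1}bx lerD2r ler_wnM2l ?ymin// leNgt.
  - by have := xmax _ (piece_stable i KSy); rewrite dotDl dotZl.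
have aE : a = r j * (if 0 < r j then a else b) + dot (v j) u.
  have ay : a = r j * dot y u + dot (v j) u by rewrite /a dotDl dotZl.
  apply/eqP; rewrite eq_le; case: ifPn => rj_pos; apply/andP; split.
  - by have := ymin _ (piece_stable j KSy); rewrite dotDl dotZl.
  - by rewrite {2}ay lerD2r ler_pM2l// ymin.
  - by have := ymin _ (piece_stable j KSx); rewrite dotDl dotZl.
  - by rewrite ay lerD2r ler_wnM2l ?xmax// leNgt.
have [bp aq] : b = dot p u /\ a = dot q u.
  have pE' : dot p u = r i * (if 0 < r i then dot p u else dot q u) + dot (v i) u.
    by rewrite {1}pE dotDl dotZl; case: ifP.
  have qE' : dot q u = r j * (if 0 < r j then dot q u else dot p u) + dot (v j) u.
    by rewrite {1}qE dotDl dotZl; case: ifP.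
  (* The differences [b - dot p u] and [a - dot q u] solve the homogeneous system and therefore
     vanish. *)
  have cancel k x' : 0 < 1 - k -> x' = k * x' -> x' = 0 :> R.
    move=> k0 /eqP; rewrite -subr_eq0 -{1}(mul1r x') -mulrBl mulf_eq0.
    by rewrite gt_eqF//= => /eqP.
  have Eb : b - dot p u = r i * (if 0 < r i then b - dot p u else a - dot q u).
    by rewrite {1}bE {1}pE'; case: ifP => _; ring.
  have Ea : a - dot q u = r j * (if 0 < r j then a - dot q u else b - dot p u).
    by rewrite {1}aE {1}qE'; case: ifP => _; ring.
  suff : b - dot p u = 0 /\ a - dot q u = 0 by lra.
  move: Eb Ea; case: ifP => _; case: ifP => _ Eb Ea.
  - by split; [exact: cancel ri0 Eb|exact: cancel rj0 Ea].
  - by have b0 := cancel _ _ ri0 Eb; split => //; rewrite Ea b0 mulr0.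
  - by have a0 := cancel _ _ rj0 Ea; split => //; rewrite Eb a0 mulr0.
  - have b0 : b - dot p u = 0 by apply: (cancel (r i * r j)) => //; rewrite -mulrA -Ea.
    by split => //; rewrite Ea b0 mulr0.
rewrite -bp -aq; split; [by exists (r i *: x + v i)|by exists (r j *: y + v j)|].
by move=> z Kz; rewrite ymin// xmax.
Qed.

Hypothesis K1 : one_set K.

(** The strict inequality excludes a projection to a single point; the moment estimate divides by
    the length. *)
Definition full_projection p q u := [/\ enorm u = 1, dot q u < dot p u,
  forall z, K z -> dot q u <= dot z u <= dot p u &
  forall t, dot q u <= t <= dot p u -> exists2 x, K x & dot x u = t].

Lemma three_full_projections p q u1 u2 u3 :
    dot u1 (perp u2) != 0 -> dot u1 (perp u3) != 0 -> dot u2 (perp u3) != 0 ->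
    full_projection p q u1 -> full_projection p q u2 -> full_projection p q u3 ->
  forall x, K x -> dot (x - 2^-1 *: (p + q)) (perp (p - q)) = 0.
Proof.
move=> h12 h13 h23 F1 F2 F3; set c := 2^-1 *: _; set d := p - q; set n := perp d.
have [l1 [l2 [l3 interp]]] := dot_sqr_interpolation n h12 h13 h23.
(* For a full projection this is the second moment of the pieces minus that of the whole interval,
   divided by the length [dot d u]. It is a quadratic form in [u], so interpolation applies. *)
pose Q W u := \sum_(w <- W) `|ratio w| * dot (f w c - c) u ^+ 2 +
  (\sum_(w <- W) `|ratio w| ^+ 3 - 1) / 12 * dot d u ^+ 2.
have Qn W : Q W n = l1 * Q W u1 + l2 * Q W u2 + l3 * Q W u3.
  rewrite /Q interp.
  rewrite (eq_bigr (fun w => l1 * (`|ratio w| * dot (f w c - c) u1 ^+ 2) +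
    l2 * (`|ratio w| * dot (f w c - c) u2 ^+ 2) +
    l3 * (`|ratio w| * dot (f w c - c) u3 ^+ 2))); last by move=> w _; rewrite interp; ring.
  by rewrite !big_split/= -!mulr_sumr; ring.
have on_line w0 : dot (f w0 c - c) n = 0.
  (* Collects the three errors [eta * dot d u / 4] with their weights; it depends neither on [W] nor
     on [eta], so [eta] can tend to 0. *)
  pose B := `|l1| * dot d u1 / 4 + `|l2| * dot d u2 / 4 + `|l3| * dot d u3 / 4.
  suff small eta : 0 < eta -> `|ratio w0| * dot (f w0 c - c) n ^+ 2 <= eta * B.
    have : `|ratio w0| * dot (f w0 c - c) n ^+ 2 <= 0.
      apply/ler_addgt0Pr => e e0; rewrite add0r.
      have B1 : 0 < `|B| + 1 by rewrite ltr_wpDl.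
      rewrite (le_trans (small _ (divr_gt0 e0 B1)))// -mulrA ger_pMr// mulrC ler_pdivrMr//.
      by have := ler_norm B; lra.
    rewrite pmulr_rle0 ?normr_gt0 ?word_ratio_neq0// => h.
    by apply/eqP; rewrite -sqrf_eq0 eq_le h sqr_ge0.
  move=> eta0; have [W [w0W W1 Wcov]] := near_tiling r_neq0 r_lt1 K0 cK KE w0 K1 eta0.
  have QW u : full_projection p q u -> `|Q W u| <= eta * dot d u / 4.
    move=> [u1E qp Kqp Kfull].
    have lE : dot d u = dot p u - dot q u by rewrite dotBl.
    have cE : dot c u = (dot q u + dot p u) / 2 by rewrite dotZl dotDl; field.
    have [|E [Ele Eeta Ecov]] := Wcov u c (dot d u / 2) u1E.
      by move=> x /Kqp; rewrite ler_norml cE lE; lra.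
    have [xp Kxp xpE] : exists2 x, K x & dot x u = dot p u by apply: Kfull; lra.
    have [xq Kxq xqE] : exists2 x, K x & dot x u = dot q u by apply: Kfull; lra.
    have := @second_moment_pieces R _ W (fun w => `|ratio w|) (fun w => dot (f w c) u)
      E (dot q u) (dot p u) eta.
    rewrite /= -lE -cE => /(_ _ _ W1 _ Ele Eeta _).
    set s := \sum_(w <- W) _; suff -> : s - dot d u ^+ 2 / 12 = Q W u.
      apply.
      - by rewrite lE subr_gt0.
      - by [].
      (* The ends of a piece are the projected images of [xp] and [xq], which lie in [K]; the sign
         of the ratio decides their order. *)
      - move=> w Ww; have := Kqp _ (word_map_stable KE w Kxp).
        have := Kqp _ (word_map_stable KE w Kxq).
        rewrite (dot_word_map _ _ w xp c) (dot_word_map _ _ w xq c) xpE xqE.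
        rewrite (_ : dot q u - dot c u = - (dot d u / 2)); last by rewrite lE cE; field.
        rewrite (_ : dot p u - dot c u = dot d u / 2); last by rewrite lE cE; field.
        by case: (ger0P (ratio w)) => _; rewrite -!mulrA; lra.
      - move=> t /andP[qt tp]; have [|x Kx <-] := Kfull t; first by rewrite !ltW.
        have [[w Ww xw]|xE] := Ecov x Kx; [left|by right].
        by exists w => //; move: xw; rewrite ler_norml -!mulrA; lra.
    rewrite /Q /s big_split/=.
    rewrite [X in _ + X - _](eq_bigr (fun w => `|ratio w| ^+ 3 * (dot d u ^+ 2 / 12))).
      rewrite -mulr_suml [in RHS](eq_bigr
        (fun w => `|ratio w| * (dot (f w c) u - dot c u) ^+ 2)); last first.
        by move=> w _; rewrite dotBl.
      by field.
    by move=> w _; field.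
  (* [dot d n = 0] removes the only term that may be negative, and the term of [w0] is one of the
     remaining ones. *)
  apply: (@le_trans _ _ (Q W n)).
    rewrite /Q (_ : dot d n = 0); last by rewrite dot_perp; ring.
    rewrite expr0n mulr0 addr0 (big_rem w0)//= lerDl.
    by apply: sumr_ge0 => w _; rewrite mulr_ge0// sqr_ge0.
  rewrite Qn /B.
  have bound l u : full_projection p q u -> l * Q W u <= eta * (`|l| * dot d u / 4).
    move=> Fu; rewrite (le_trans (ler_norm _))// normrM.
    rewrite (_ : eta * _ = `|l| * (eta * dot d u / 4)); last by field.
    by rewrite ler_wpM2l// QW.
  by have := bound l1 _ F1; have := bound l2 _ F2; have := bound l3 _ F3; lra.
move=> x Kx; have [D D0 KD] := compact_enorm_bounded K0 cK.
pose B := D * enorm n + `|dot (x - c) n|.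
have KB y : K y -> `|dot (y - c) n| <= B.
  move=> Ky; rewrite (_ : dot (y - c) n = dot (y - x) n + dot (x - c) n); last first.
    by rewrite !dotBl; ring.
  rewrite (le_trans (ler_normD _ _))// lerD2r (le_trans (dot_enorm _ _))//.
  by rewrite ler_wpM2r ?enorm_ge0// KD.
have B0 : 0 <= B by rewrite (le_trans _ (KB x Kx)).
apply/eqP; rewrite -normr_le0; apply/ler_addgt0Pr => e e0; rewrite add0r.
have B1 : 0 < B + 1 by rewrite ltr_wpDl.
(* A point of [K] in a small cylinder is close to the image of [c] under the same word, which is on
   the line. *)
have [N HN] := word_ratio_small r_lt1 (divr_gt0 e0 B1).
have [w wN [y Ky <-]] := cylinder_cover KE N Kx.
have -> : dot (f w y - c) n = dot (f w c - c) n + ratio w * dot (y - c) n.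
  by rewrite !dotBl (dot_word_map _ _ w y c); ring.
rewrite on_line add0r normrM.
apply: (@le_trans _ _ (e / (B + 1) * B)); first by rewrite ler_pM ?HN ?KB.
by rewrite -mulrA ger_pMr// mulrC ler_pdivrMr//; lra.
Qed.

End Homotheties.

(** * Finiteness of the set of lines *)

Lemma finite_set_no_triple (T : Type) (A : set T) :
  (forall x y z, A x -> A y -> A z -> x <> y -> x <> z -> y <> z -> False) ->
  finite_set A.
Proof.
move=> A3; have [[x Ax]|/nonemptyPn ->] := pselect (A !=set0); last exact: finite_set0.
have [[y [Ay xy]]|Ax1] := pselect (exists y, A y /\ x <> y); last first.
  apply: (sub_finite_set _ (finite_set1 x)) => y Ay /=.
  by apply: contrapT => yx; apply: Ax1; exists y; split=> // xy; apply: yx.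
apply: (sub_finite_set _ (finite_set2 x y)) => z Az /=.
by apply: contrapT => /not_orP[zx zy]; apply: (A3 x y z) => // E; [apply: zx|apply: zy].
Qed.

Theorem theorem1p3 (R : realType) (m : nat)
    (S : 'I_m -> 'rV[R]_2 -> 'rV[R]_2) (K : set 'rV[R]_2)
    (hS : forall i, contracting_similarity (S i))
    (hK : is_attractor S K)
    (hhom : forall i, homothety (S i))
    (h1 : one_set K)
    (hline : forall L : set 'rV[R]_2, is_line L -> ~ K `<=` L) :
  finite_set [set M : {vspace 'rV[R]_2} |
               \dim M = 1%N /\ interval_projection K M].
Proof.
have [r /choice[v hrv]] := choice hhom.
have r0 i : r i != 0 by have [] := hrv i.
have SE i x : S i x = r i *: x + v i by have [_ ->] := hrv i.
have r1 i : `|r i| < 1.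
  have [rho [/andP[_ rho1] Srho]] := hS i.
  (* Any nonzero vector shows that the similarity ratio of [S i] is the absolute value of [r i]. *)
  have one0 : const_mx 1 != 0 :> 'rV[R]_2.
    by apply/eqP => /rowP/(_ ord0)/eqP; rewrite !mxE oner_eq0.
  have := Srho (const_mx 1) 0; rewrite !SE opprD addrACA subrr addr0 -scalerBr enormZ.
  by rewrite subr0 => /(mulIf (lt0r_neq0 (enorm_gt0 one0))) ->.
have [K0 cK KS] := hK.
have KE : K = \bigcup_(i in [set: 'I_m]) ((fun x => r i *: x + v i) @` K).
  by rewrite {1}KS; apply: eq_bigcupr => i _; congr (_ @` K); apply/funext => x.
(* The lines are sorted by extremal pair; each of these finitely many classes has at most two
   members. *)
pose A ij := [set M : {vspace 'rV[R]_2} | exists e, [/\ \dim M = 1%N, e \in M,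
  enorm e = 1, is_interval [set t | exists2 x, K x & dot x e = t] &
  extremal_pieces r v K e ij.1 ij.2]].
suff Afin ij : finite_set (A ij).
  apply: (@sub_finite_set _ _ (\bigcup_(ij in [set: 'I_m * 'I_m]) A ij)); last first.
    by apply: bigcup_finite; [exact: finite_finset|move=> ij _; exact: Afin].
  move=> M [dM [e [eM e1 eint]]].
  have [i [j eij]] := ex_extremal_pieces K0 cK KE e.
  exists (i, j) => //; exists e; split=> //.
  suff -> : [set t | exists2 x, K x & dot x e = t] =
    [set t | (orth_proj M @` K) (t *: e)] by [].
  have e0 := enorm1_neq0 e1.
  apply/seteqP; split=> t [x Kx]; last first.
    by rewrite (orth_proj_unit x dM eM e1) => /eqP; rewrite -subr_eq0 -scalerBl scaler_eq0
      (negPf e0) orbF subr_eq0 => /eqP xe; exists x.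
  by move=> <-; exists x => //; rewrite (orth_proj_unit x dM eM e1).
case: ij => i j; have [p [q pq]] := extremal_endpoints r1 KE i j.
have full e : enorm e = 1 -> is_interval [set t | exists2 x, K x & dot x e = t] ->
    extremal_pieces r v K e i j -> full_projection K p q e.
  move=> e1 eint /pq[[x Kx xE] [y Ky yE] Kpq]; split=> //.
  - rewrite lt_neqAle; apply/andP; split; last by have /andP[/le_trans] := Kpq x Kx; apply.
    (* A one-point projection would put [K] on a line orthogonal to [e]. *)
    apply/eqP => qp.
    apply: (not_subset_perp_line (c := q) hline (enorm1_neq0 e1)) => z /Kpq.
    by rewrite dotBl -qp => zq; lra.
  - move=> t; apply: eint; [by exists y|by exists x].
have indep (M1 M2 : {vspace 'rV[R]_2}) e1 e2 : \dim M1 = 1%N -> \dim M2 = 1%N ->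
    e1 \in M1 -> e2 \in M2 -> enorm e1 = 1 -> enorm e2 = 1 -> M1 <> M2 ->
    dot e1 (perp e2) != 0.
  move=> d1 d2 m1 m2 n1 n2 M12; apply/eqP => /(dot_perp_vline (enorm1_neq0 n2)) e12.
  apply: M12; transitivity <[e1]>%VS.
    by apply/esym/eqP; rewrite eqEdim -memvE m1 dim_vline enorm1_neq0// d1.
  apply/eqP; rewrite eqEdim dim_vline enorm1_neq0// d2 andbT -memvE.
  by move: e12 => /vlineP[k ->]; rewrite memvZ.
apply: finite_set_no_triple => M1 M2 M3 [e1 [d1 m1 n1 i1 x1]] [e2 [d2 m2 n2 i2 x2]]
  [e3 [d3 m3 n3 i3 x3]] M12 M13 M23.
have F1 := full _ n1 i1 x1.
(* [p] and [q] differ because they project to different points in direction [e1]. *)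
have pq0 : perp (p - q) != 0.
  apply: contraTneq isT => /perp_eq0 d0.
  by case: F1 => _ + _ _; rewrite -subr_gt0 -dotBl d0 -(scale0r (0 : 'rV[R]_2)) dotZl mul0r ltxx.
apply: (not_subset_perp_line hline pq0).
apply: (three_full_projections r0 r1 K0 cK KE h1 _ _ _ F1 (full _ n2 i2 x2) (full _ n3 i3 x3)).
- exact: (indep M1 M2).
- exact: (indep M1 M3).
- exact: (indep M2 M3).
Qed.
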